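(* Let an empirical model on a tested family $\mathcal C\subseteq\mathcal C_1\times\cdots\times\mathcal C_n$ of multipartite contexts have a GLHV representation $$p_C(\mathbf m_C)=\sum_\lambda q(\lambda)\prod_{i=1}^n p_i(\mathbf m_{C_i}|C_i,\lambda),\qquad C=(C_1,\dots,C_n)\in\mathcal C,$$ with one probability distribution $q(\lambda)$ shared by all $C\in\mathcal C$. Suppose that for every party $i$ and every $\lambda$ there are a probability distribution $q_{i,\lambda}(\sigma_i)$ of an auxiliary variable $\sigma_i$ (the same for all local contexts $C_i$) and response distributions $p_i(\cdot|j,\sigma_i,\lambda)$, one for each measurement $j$ of party $i$ and independent of the context, such that for every local context $C_i$ $$p_i(\mathbf m_{C_i}|C_i,\lambda)=\sum_{\sigma_i}q_{i,\lambda}(\sigma_i)\prod_{j\in C_i}p_i(m_{ij}|j,\sigma_i,\lambda).$$ Then the empirical model on $\mathcal C$ admits a GNCHV model.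
   Context: There are $n$ parties. Party $i$ has a set $\mathcal M_i$ of measurements and a family $\mathcal C_i$ of local contexts; a local context $C_i\in\mathcal C_i$ is a set of compatible measurements of party $i$, $m_{ij}$ denotes the outcome of $j\in C_i$, and $\mathbf m_{C_i}=\{m_{ij}\}_{j\in C_i}$. A multipartite context is $C=(C_1,\dots,C_n)$ with joint outcome $\mathbf m_C=\{\mathbf m_{C_i}\}_{i=1}^n$. The empirical model assigns to each $C\in\mathcal C$ a probability distribution $p_C$ of joint outcomes. In a GLHV representation the block responses $p_i(\cdot|C_i,\lambda)$ are arbitrary joint probability distributions of the outcomes of the measurements in $C_i$. GNCHV model: one hidden variable $\xi$, one probability distribution $q(\xi)$, and context-independent response distributions $p(\cdot|j,\xi)$, one for each measurement $j\in\bigcup_i\mathcal M_i$ (the sets $\mathcal M_i$ of different parties are regarded as disjoint), such that $p_C(\mathbf m_C)=\sum_\xi q(\xi)\prod_{i=1}^n\prod_{j\in C_i}p(m_{ij}|j,\xi)$ for every $C\in\mathcal C$. Hidden variables range over discrete sets. *)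

(* Defs.v *)
From HB Require Import structures.
From mathcomp Require Import all_boot all_order all_algebra finmap.
From mathcomp Require Import all_classical all_reals all_analysis.

Set Implicit Arguments.
Unset Strict Implicit.
Unset Printing Implicit Defensive.

Import Order.TTheory GRing.Theory Num.Theory.
Local Open Scope classical_set_scope.
Local Open Scope ring_scope.

(* Probability mass function on an arbitrary (discrete) set; [esum] is the
   unordered sum, so no countability of [T] is required. *)
Definition is_distr (R : realType) (T : choiceType) (p : T -> R) : Prop :=
  (forall x, 0 <= p x) /\ (\esum_(x in [set: T]) (p x)%:E = 1)%E.

(* Party [i : 'I_n] has its own type [M i] of measurements, so that the sets of
   measurements of different parties are disjoint by construction. The outcome
   set [O i j] is allowed to depend on the measurement [j : M i]. *)
Section Scenario.
Variables (R : realType) (n : nat).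
Variables (M : 'I_n -> choiceType) (O : forall i, M i -> choiceType).

Definition local_outcome (i : 'I_n) (Ci : {fset M i}) : choiceType :=
  {dffun forall j : Ci, O (val j)}.

Definition context : Type := forall i : 'I_n, {fset M i}.

Definition joint_outcome (C : context) : choiceType :=
  {dffun forall i : 'I_n, local_outcome (C i)}.

(* Only the values of [p] on the tested family [T] are meaningful; the same
   convention is used for local contexts below. *)
Definition empirical_model (T : set context)
    (p : forall C : context, joint_outcome C -> R) : Prop :=
  forall C, T C -> is_distr (p C).

(* [K i] is the family of local contexts of party [i]. *)
Definition GLHV_representation (K : forall i, set {fset M i})
    (T : set context) (p : forall C : context, joint_outcome C -> R)
    (L : choiceType) (q : L -> R)
    (b : forall i (Ci : {fset M i}), L -> local_outcome Ci -> R) : Prop :=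
  [/\ is_distr q,
      (forall i (Ci : {fset M i}) l, K i Ci -> is_distr (b i Ci l)) &
      (forall C, T C -> forall m : joint_outcome C,
         (p C m)%:E = \esum_(l in [set: L])
           (q l * \prod_(i < n) b i (C i) l (m i))%:E)].

Definition has_GNCHV_model (T : set context)
    (p : forall C : context, joint_outcome C -> R) : Prop :=
  exists (X : choiceType) (q : X -> R)
         (r : forall i (j : M i), X -> O j -> R),
  [/\ is_distr q,
      (forall i (j : M i) x, is_distr (r i j x)) &
      (forall C, T C -> forall m : joint_outcome C,
         (p C m)%:E = \esum_(x in [set: X])
           (q x * \prod_(i < n) \prod_(j : C i) r i (val j) x (m i j))%:E)].

End Scenario.

(* Main.v *)
Require Import Defs.
From HB Require Import structures.
From mathcomp Require Import all_boot all_order all_algebra finmap.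
From mathcomp Require Import all_classical all_reals all_analysis.

Set Implicit Arguments.
Unset Strict Implicit.
Unset Printing Implicit Defensive.

Import Order.TTheory GRing.Theory Num.Theory.
Local Open Scope classical_set_scope.
Local Open Scope ring_scope.

(* The hidden variable of the global model is the family (l, (s_i)_i) of the
   shared variable and the auxiliary variables of all parties, where, given l,
   the s_i are drawn independently:
     q(l, s) = q(l) * \prod_i q_{i,l}(s_i).
   Distributing the product of the n local sums over s_i into one sum over the
   families s turns the nested representation into the global one. *)

Lemma ge0_esumZl (R : realType) (T : choiceType) (A : set T) (a : T -> \bar R)
    (c : R) : 0 <= c -> (forall x, (0 <= a x)%E) ->
  (\esum_(x in A) (c%:E * a x) = c%:E * \esum_(x in A) a x)%E.
Proof.
move=> c0 a0; rewrite /esum -ereal_supZl//; last first.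
  (* Moving [c] out of the supremum asks for a nonempty set of partial sums; the empty partial sum
     is a member. *)
  apply/set0P; exists (\sum_(x \in set0) a x)%E; exists set0 => //.
  exact: fsets_set0.
rewrite image_comp; congr ereal_sup; apply: eq_imagel => X [finX XA] /=.
by rewrite ge0_mule_fsumr.
Qed.

(** The map sending [x] to [(tag x, x)] is a bijection onto the pairs of an index and a point of its
    fibre, and the fibre over [i] is the injective image of [S i] under [Tagged S]. *)
Lemma esum_sigT (R : realType) (I : choiceType) (S : I -> choiceType)
    (a : {i : I & S i} -> \bar R) : (forall x, (0 <= a x)%E) ->
  (\esum_(x in [set: {i : I & S i}]) a x =
   \esum_(i in [set: I]) \esum_(s in [set: S i]) a (Tagged S s))%E.
Proof.
move=> a0.
transitivity (\esum_(i in [set: I]) \esum_(x in range (@Tagged _ i S)) a x)%E.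
  rewrite (esum_esum (a := fun=> a))//.
  rewrite (@reindex_esum _ _ _ [set: {i : I & S i}] _ (fun x => (tag x, x)))//.
  split=> [[i s] _|x y _ _ /(congr1 snd)//|[i x] [_ [s _ /= <-]]].
    by split=> //; exists s.
  by exists (Tagged S s).
apply: eq_esum => i _; rewrite esum_image// => s t _ _ /eqP.
by rewrite eq_Tagged => /eqP.
Qed.

Section ProductSum.
Variables (R : realType) (I : finType) (S : I -> choiceType).
Variables (s0 : forall i, S i) (f : forall i, S i -> R) (w : I -> R).
Hypothesis f0 : forall i (s : S i), 0 <= f s.
Hypothesis fw : forall i, (\esum_(s in [set: S i]) (f s)%:E = (w i)%:E)%E.

(* Families free to vary on [r] and pinned to [s0] elsewhere: adding an index to
   [r] amounts to one more, independent, summation. *)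
Let fixed_off (r : seq I) : set {dffun forall i, S i} :=
  [set s | forall i, i \notin r -> s i = s0 i].

Let esum_prod_seq (r : seq I) : uniq r ->
  (\esum_(s in fixed_off r) (\prod_(i <- r) f (s i))%:E
   = (\prod_(i <- r) w i)%:E)%E.
Proof.
elim: r => [|k r IHr] /=.
  move=> _; have -> : fixed_off [::] = [set [ffun i => s0 i]].
    apply/seteqP; split=> [s sE|_ -> i _]; last by rewrite ffunE.
    by apply/ffunP => i; rewrite ffunE sE.
  by rewrite esum_set1 ?big_nil// lee_fin.
move=> /andP[kr ur].
(* Overwriting coordinate [k] maps [fixed_off r] times [S k] bijectively onto [fixed_off (k :: r)],
   and leaves the factors indexed by [r] unchanged because [k] is not in [r]. *)
pose upd (x : {dffun forall i, S i} * S k) : {dffun forall i, S i} :=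
  [ffun i => eqtype.dfwith (fun i => x.1 i) x.2 i].
have updk x : upd x k = x.2 by rewrite ffunE eqtype.dfwith_in.
have updN x i : i != k -> upd x i = x.1 i.
  by move=> ik; rewrite ffunE eqtype.dfwith_out// eq_sym.
have prod_upd x : \prod_(i <- r) f (upd x i) = \prod_(i <- r) f (x.1 i).
  apply: eq_big_seq => i ir; rewrite updN//.
  by apply: contraNneq kr => <-.
rewrite (@reindex_esum _ _ _ (fixed_off r `*`` (fun=> [set: S k])) _ upd).
  under eq_esum do rewrite big_cons prod_upd updk mulrC.
  rewrite -(esum_esum
      (a := fun (s : {dffun forall i, S i}) t => (\prod_(i <- r) f (s i) * f t)%:E));
    last by move=> s t _ _; rewrite lee_fin mulr_ge0// prodr_ge0.
  transitivity (\esum_(s in fixed_off r) ((w k)%:E * (\prod_(i <- r) f (s i))%:E))%E.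
    apply: eq_esum => s _; under eq_esum do rewrite EFinM.
    by rewrite ge0_esumZl ?prodr_ge0//; [rewrite fw muleC|move=> t; rewrite lee_fin].
  rewrite ge0_esumZl ?IHr// ?big_cons ?EFinM//.
    (* [w k] is nonnegative, being a sum of nonnegative terms. *)
    by rewrite -lee_fin -fw; apply: esum_ge0 => s _; rewrite lee_fin.
  by move=> s; rewrite lee_fin prodr_ge0.
split.
- move=> x [x1 _] i; rewrite inE negb_or => /andP[ik ir].
  by rewrite updN// x1.
- move=> [s t] [s' t'] /set_mem[/= sr _] /set_mem[/= sr' _] st.
  have <- : t = t' by rewrite -[t](updk (s, t)) -[RHS](updk (s', t')) st.
  congr pair; apply/ffunP => i; have [->|ik] := eqVneq i k.
    by rewrite sr// sr'.
  by rewrite -(updN (s, t))// st updN.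
(* The preimage of [s] remembers the value [s k] and resets coordinate [k] to its pinned value
   [s0 k]. *)
- move=> s sr; exists (upd (s, s0 k), s k).
    split=> //= i ir; have [->|ik] := eqVneq i k; first exact: updk.
    by rewrite updN// sr// inE negb_or ik.
  apply/ffunP => i; have [->|ik] := eqVneq i k; first exact: updk.
  by rewrite !updN.
Qed.

(** When [r] enumerates all of [I], no coordinate is pinned and [fixed_off r] is the full set of
    families. *)
Lemma esum_prod_dffun :
  (\esum_(s in [set: {dffun forall i, S i}]) (\prod_i f (s i))%:E
   = (\prod_i w i)%:E)%E.
Proof.
rewrite -esum_prod_seq ?index_enum_uniq//; congr esum.
by apply/esym/seteqP; split=> // s _ i; rewrite mem_index_enum.
Qed.

End ProductSum.

(** A sum over an empty type is 0, not 1. This supplies the base points [s0] at which coordinates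
    are pinned. *)
Lemma is_distr_inhabited (R : realType) (T : choiceType) (p : T -> R) :
  is_distr p -> [set: T] !=set0.
Proof.
move=> [_ p1]; apply: contrapT => T0.
have : (\esum_(x in [set: T]) (p x)%:E = 0)%E.
  by apply: esum1 => x; case: T0; exists x.
by rewrite p1 => -[] /eqP; rewrite oner_eq0.
Qed.

Theorem mainTheorem5 (R : realType) (n : nat)
    (M : 'I_n -> choiceType) (O : forall i, M i -> choiceType)
    (K : forall i, set {fset M i})
    (T : set (context M))
    (T_sub : forall C, T C -> forall i, K i (C i))
    (p : forall C : context M, joint_outcome O C -> R)
    (p_emp : empirical_model T p)
    (L : choiceType) (q : L -> R)
    (b : forall i (Ci : {fset M i}), L -> local_outcome O Ci -> R)
    (p_GLHV : GLHV_representation K T p q b)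
    (b_NC : forall (i : 'I_n) (l : L),
       exists (S : choiceType) (qS : S -> R)
              (r : forall j : M i, S -> O i j -> R),
       [/\ is_distr qS,
           (forall (j : M i) (s : S), is_distr (r j s)) &
           (forall Ci : {fset M i}, K i Ci ->
            forall m : local_outcome O Ci,
              (b i Ci l m)%:E = \esum_(s in [set: S])
                (qS s * \prod_(j : Ci) r (val j) s (m j))%:E)]) :
  has_GNCHV_model T p.
Proof.
case: p_GLHV => [[q0 q1] _ pE].
(* Choice picks the auxiliary variable, its distribution and its responses for all [i] and [l] at
   once. *)
pose S i l := sval (cid (b_NC i l)).
pose qS i l : S i l -> R := sval (cid (svalP (cid (b_NC i l)))).
pose r i l : forall j : M i, S i l -> O i j -> R :=
  sval (cid (svalP (cid (svalP (cid (b_NC i l)))))).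
have NC i l := svalP (cid (svalP (cid (svalP (cid (b_NC i l)))))).
have qS_distr i l : is_distr (qS i l) by have [h _ _] := NC i l; exact: h.
have r_distr i l j s : is_distr (r i l j s) by have [_ h _] := NC i l; exact: h.
have bE i l (Ci : {fset M i}) (m : local_outcome O Ci) : K i Ci ->
    (b i Ci l m)%:E = \esum_(s in [set: S i l])
      (qS i l s * \prod_(j : Ci) r i l (val j) s (m j))%:E.
  by move=> KCi; have [_ _ h] := NC i l; exact: h.
have s0 i l : S i l by have [] := cid (is_distr_inhabited (qS_distr i l)).
have qS0 i l s : 0 <= qS i l s by case: (qS_distr i l).
have r0 i l j s o : 0 <= r i l j s o by case: (r_distr i l j s).
clearbody S qS r.
pose X l : choiceType := {dffun forall i, S i l}.
pose at_party (x : {l : L & X l}) i : S i (tag x) :=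
  (tagged x : {dffun forall i, S i (tag x)}) i.
(* For fixed [l] the sum over families factors through the parties. It serves twice: with [w] the
   block responses, and with [w] constantly 1 for normalization. *)
have sum_party l c (f : forall i, S i l -> R) (w : 'I_n -> R) : 0 <= c ->
    (forall i s, 0 <= f i s) ->
    (forall i, \esum_(s in [set: S i l]) (f i s)%:E = (w i)%:E) ->
  \esum_(s in [set: X l]) (c * \prod_(i < n) f i (at_party (Tagged X s) i))%:E
  = (c * \prod_(i < n) w i)%:E.
  move=> c0 f0 fw; under eq_esum do rewrite EFinM.
  rewrite ge0_esumZl//; last by move=> s; rewrite lee_fin prodr_ge0.
  by rewrite EFinM -(esum_prod_dffun (fun i => s0 i l) f0 fw).
(* The range of the auxiliary variables depends on [l], hence a dependent pair. *)
exists {l : L & X l}.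
exists (fun x => q (tag x) * \prod_(i < n) qS i (tag x) (at_party x i)).
exists (fun i j x => r i (tag x) j (at_party x i)).
split=> [|i j x|C TC m]; last 2 first.
- exact: r_distr.
- rewrite pE// esum_sigT; last first.
    by move=> x; rewrite lee_fin !mulr_ge0// prodr_ge0// => i _; rewrite prodr_ge0.
  apply: eq_esum => l _.
  rewrite -(sum_party l (q l)
    (fun i s => qS i l s * \prod_(j : C i) r i l (val j) s (m i j))
    (fun i => b i (C i) l (m i)))//.
  + by apply: eq_esum => s _; rewrite big_split/= mulrA.
  + by move=> i s; rewrite mulr_ge0// prodr_ge0.
  + by move=> i; rewrite bE//; exact: T_sub.
split=> [x|]; first by rewrite mulr_ge0// prodr_ge0.
rewrite esum_sigT; last by move=> x; rewrite lee_fin mulr_ge0// prodr_ge0.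
rewrite -q1; apply: eq_esum => l _.
(* Each [qS i l] has total mass 1, so the families above [l] carry total weight [q l]. *)
transitivity ((q l * \prod_(i < n) (1 : R))%:E); last by rewrite big1// mulr1.
by apply: (sum_party l (q l) (fun i => qS i l)) => // i; case: (qS_distr i l).
Qed.
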